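(* Let $K\in\{2,3,\dots\}$ and let $\phi:[0,1]\to[-\infty,\infty]$ be a strictly decreasing continuous function with $\phi(0)=\infty$, with inverse $\psi$. Then for every $\epsilon\in(0,1)$ such that $\phi(\epsilon)\ge0$, and all random variables $p_1,\dots,p_K$ on a common probability space, each uniformly distributed on $[0,1]$ (with arbitrary dependence), $$\mathbb{P}\left(M_{\phi,K}(p_1,\dots,p_K)\le\epsilon\right)\le\inf_{t\in(0,\phi(\epsilon)]}\frac{\int_{\phi(\epsilon)-t}^{\phi(\epsilon)+(K-1)t}\psi(u)\,du}{t}.$$
   Context: For $\phi$ as in the claim, $\psi:\phi([0,1])=[\phi(1),\infty]\to[0,1]$ is its inverse, and $M_{\phi,K}(p_1,\dots,p_K):=\psi\left(\frac{\phi(p_1)+\dots+\phi(p_K)}{K}\right)$ (almost surely well defined for uniformly distributed $p_k$, since infinite values of $\phi$ can occur only at $0$ and $1$). In the integral, $\psi$ is extended by $\psi(u):=1$ for real $u<\phi(1)$, so that $\psi(u)=\mathbb{P}(\phi(U)>u)$ for all real $u$, with $U$ uniform on $[0,1]$. The infimum over the empty set (case $\phi(\epsilon)=0$) is $+\infty$. *)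

(* Defs.v *)
(* MathComp-Analysis *)
From mathcomp Require Export all_boot all_order all_algebra.
From mathcomp Require Export all_classical all_reals all_analysis.
Export Order.TTheory GRing.Theory Num.Theory.
Export numFieldNormedType.Exports.

Set Implicit Arguments.
Unset Strict Implicit.
Unset Printing Implicit Defensive.

Local Open Scope classical_set_scope.
Local Open Scope ring_scope.

(* A function on [0,1] is a function on R of which only the values on `[0, 1]
   are constrained. A variable that is uniform on [0,1] may leave [0,1] on a
   null set, where phi carries no information; events involving phi are
   therefore taken on the almost sure set where all variables lie in `[0, 1]. *)

(* The laws are compared on measurable sets only: off them the value of a
   MathComp-Analysis measure carries no meaning. *)
Definition uniform01 d (T : measurableType d) (R : realType)
    (P : probability T R) (X : {RV P >-> R}) : Prop :=
  forall A : set R, measurable A ->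
    distribution P X A = uniform_prob (@ltr01 R) A.

(* If phi 1 = -oo, the sum may mix +oo and -oo; it is then -oo (the convention
   of \bar R), which belongs to phi @` `[0, 1]. For uniform arguments this
   happens on a null set. *)
Definition Mphi (R : realType) (phi : R -> \bar R) (psi : \bar R -> R) (K : nat)
    (p : 'I_K -> R) : R :=
  psi ((\sum_(k < K) phi (p k)) / K%:R%:E)%E.

(* psi, given on phi @` `[0, 1] = [phi 1, +oo], extended by 1 to the reals
   below phi 1. *)
Definition psi_ext (R : realType) (phi : R -> \bar R) (psi : \bar R -> R)
    (u : R) : R :=
  if (u%:E < phi 1%R)%E then 1 else psi u%:E.

(* Main.v *)
Require Import Defs.
From mathcomp Require Import measurable_realfun ring.

Set Implicit Arguments.
Unset Strict Implicit.
Unset Printing Implicit Defensive.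
Local Open Scope classical_set_scope.
Local Open Scope ring_scope.

(** The event forces the sum of the phi (p k) to be at least K * s, where
    s = phi eps. Put a = s - t and b = s + (K - 1) t, so that b - a = K t.
    The key is a deterministic inequality ([sum_truncations_ge]): if K
    extended real numbers have sum at least K * s, then the lengths of the
    intervals [a, b] /\ ]-oo, x k[ add up to at least K t. Either some x k
    exceeds b, and its interval already has length b - a = K t; or every x k
    is at most b, each length is at least x k - a, and these differences add
    up to at least K s - K a = K t. The lengths, divided by K t, are the
    truncations of (x k - a) / (K t) to [0, 1], a dual function in the sense
    of optimal transport. The inequality is pointwise and its right-hand side
    is a sum of functions of single variables, so that only the marginal laws
    remain after integration, whatever the dependence.

    Integrating over the probability space and exchanging the integrals by
    Tonelli's theorem turns the expected length into the integral over [a, b]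
    of the survival function P (phi (p k) > u) ([sum_survival_ge]). For a
    uniform p k this survival function is psi (u), extended by 1 below phi 1,
    because the set where phi exceeds u is an interval starting at 0
    ([uniform_phi_out]). The K integrals are equal, and dividing by K t gives
    the bound for each t.

    Translating the event into a lower bound on the sum uses that the mean of
    the phi (p k) lies in the range of phi, that is, the intermediate value
    theorem for functions with extended real values ([IVT_ereal_decr]). *)

(** * The dual inequality and its integration *)

Lemma sum_truncations_ge (R : realType) (K : nat) (s t : R) (x : 'I_K -> \bar R) :
  0 < t -> ((K%:R * s)%:E <= \sum_(k < K) x k)%E ->
  ((K%:R * t)%:E <= \sum_(k < K) lebesgue_measure
     (`[(s - t)%R, (s + (K%:R - 1) * t)%R] `&` [set u | (u%:E < x k)%E]))%E.
Proof.
move=> t0 hx; set a := s - t; set b := s + _.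
have ba : b - a = K%:R * t by rewrite /a /b; ring.
have xNy k : x k != -oo%E.
  apply/eqP => xk; move: hx; suff -> : (\sum_(k < K) x k)%E = -oo%E by [].
  by apply/esum_eqNyP; exists k; rewrite mem_index_enum.
(* A single x j beyond b contributes the full length b - a; the other lengths
   are only bounded below by 0, so this case also covers infinite x j. *)
have [[j bj]|nb] := pselect (exists j, (b%:E < x j)%E).
  rewrite (bigD1 j)//=; apply: le_trans (leeDl _ _); last exact: sume_ge0.
  rewrite setIidl; last first.
    by move=> u /=; rewrite in_itv/= => /andP[_ ub]; exact: le_lt_trans bj.
  rewrite lebesgue_measure_itv/= lte_fin -EFinB ba; case: ltP => //.
  by rewrite lee_fin -ba subr_le0.
have xb k : (x k <= b%:E)%E.
  by rewrite leNgt; apply/negP => bk; apply: nb; exists k.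
have xE k : x k = (fine (x k))%:E.
  by rewrite fineK// fin_numElt ltNye xNy (le_lt_trans (xb k)) ?ltry.
have xkb k : fine (x k) <= b by rewrite -lee_fin -xE.
have xs : K%:R * s <= \sum_(k < K) fine (x k).
  by rewrite -lee_fin -sumEFin; under eq_bigr do rewrite -xE.
apply: (@le_trans _ _ (\sum_(k < K) (fine (x k) - a)%:E)%E).
  rewrite sumEFin lee_fin sumrB sumr_const card_ord -[a *+ K]mulr_natl.
  have -> : K%:R * t = K%:R * s - K%:R * a by rewrite /a; ring.
  exact: lerB.
apply: lee_sum => k _; have [ax|xa] := leP (fine (x k)) a.
  by apply: (@le_trans _ _ 0%E); rewrite ?measure_ge0// lee_fin subr_le0.
have -> : `[a, b] `&` [set u | (u%:E < x k)%E] = `[a, fine (x k)[%classic.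
  apply/seteqP; split => u /=; rewrite !in_itv/= xE lte_fin.
    by move=> [/andP[-> _] ->].
  by move=> /andP[-> ux]; split=> //; exact: le_trans (ltW ux) (xkb k).
by rewrite lebesgue_measure_itv/= lte_fin xa -EFinB.
Qed.

Lemma measurable_hypograph d (T : measurableType d) (R : realType)
    (f : T -> \bar R) (D : set R) :
  measurable_fun setT f -> measurable D ->
  measurable [set z : T * R | D z.2 /\ (z.2%:E < f z.1)%E].
Proof.
move=> mf mD.
have -> : [set z : T * R | D z.2 /\ (z.2%:E < f z.1)%E] =
   (snd @^-1` D) `&` [set z | (z.2%:E < f z.1)%E] by [].
apply: measurableI.
  by rewrite -[X in measurable X]setTI; exact: measurable_snd.
rewrite -[X in measurable X]setTI; apply: measurable_lte => //.
  by apply: (@measurableT_comp _ _ _ _ _ _ EFin _ snd).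
by apply: (@measurableT_comp _ _ _ _ _ _ f _ fst).
Qed.

(** Tonelli's theorem, applied to the region below the graph of [X k], is what
    replaces the expected length of the truncated interval by the integral of
    the survival function; only the marginal laws are left on the right. *)
Lemma sum_survival_ge d (T : measurableType d) (R : realType)
    (P : probability T R) (K : nat) (X : 'I_K -> T -> \bar R) (s t : R) :
  (forall k, measurable_fun setT (X k)) -> 0 < t ->
  ((K%:R * t)%:E * P [set w | ((K%:R * s)%:E <= \sum_(k < K) X k w)%E] <=
   \sum_(k < K) \int[lebesgue_measure]_(u in
      `[(s - t)%R, (s + (K%:R - 1) * t)%R]) P [set w | u%:E < X k w])%E.
Proof.
move=> mX t0; set F := [set w | _]; set D := [set` _].
have mD : measurable D by exact: measurable_itv.
have mF : measurable F.
  rewrite -[F]setTI; apply: measurable_lee => //.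
  exact: emeasurable_sum.
pose H k := [set z : T * R | D z.2 /\ (z.2%:E < X k z.1)%E].
have mH k : measurable (H k) by exact: measurable_hypograph (mX k) mD.
have xH k w : xsection (H k) w = D `&` [set u | (u%:E < X k w)%E].
  by rewrite /xsection; apply/seteqP; split => u /=; rewrite inE.
have intH k : (\int[lebesgue_measure]_(u in D) P [set w | u%:E < X k w] =
    \int[P]_w lebesgue_measure (D `&` [set u | u%:E < X k w]))%E.
  have e : (\int[P]_w lebesgue_measure (xsection (H k) w) =
            \int[lebesgue_measure]_u P (ysection (H k) u))%E.
    have := @indic_fubini_tonelli _ _ T _ R P (@lebesgue_measure R) _ (mH k).
    rewrite (indic_fubini_tonelli_FE (@lebesgue_measure R) (mH k)) => ->.
    apply: eq_integral => u _.
    exact: (congr1 (@^~ u) (indic_fubini_tonelli_GE P (mH k))).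
  rewrite -(eq_integral _ _ (fun w _ => congr1 lebesgue_measure (xH k w))).
  rewrite [RHS]e [LHS]integral_mkcond; apply: eq_integral => u _ /=.
  rewrite patchE; case: ifPn => [/set_mem Du|/negP nDu].
    by congr (P _); rewrite /ysection; apply/seteqP; split=> w /=; rewrite inE => //= -[].
  suff -> : ysection (H k) u = set0 by rewrite measure0.
  by rewrite -subset0 => w; rewrite /ysection/= inE => -[/mem_set].
under eq_bigr do rewrite intH.
have mf k : measurable_fun setT
    (fun w => lebesgue_measure (D `&` [set u | (u%:E < X k w)%E])).
  have := measurable_fun_xsection (@lebesgue_measure R) (mH k).
  by apply: eq_measurable_fun => w _; rewrite /= xH.
rewrite -ge0_integral_sum//.
rewrite -[F]setIT -integral_indic// -ge0_integralZl//; last 2 first.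
- by apply/measurable_EFinP.
- by rewrite lee_fin mulr_ge0// ltW.
apply: ge0_le_integral => //.
- by move=> w _; rewrite mule_ge0// lee_fin// mulr_ge0// ltW.
- by apply: measurable_funeM; apply/measurable_EFinP.
- exact: emeasurable_sum.
move=> w _; rewrite indicE; case: (boolP (w \in F)) => [/set_mem Fw|_].
  by rewrite mule1; exact: sum_truncations_ge.
by rewrite mule0 sume_ge0.
Qed.

(** * The intermediate value theorem in the extended reals *)

(** The metric of the extended reals is by construction the distance between
    the images under [contract]. *)
Lemma continuous_contract (R : realType) : continuous (@contract R).
Proof.
move=> x; apply/cvgrPdist_lt => e e0.
exact: (@nbhsx_ballx R (\bar R) x e e0).
Qed.

(** [contract] embeds the extended reals increasingly into [-1, 1], so that the
    intermediate value theorem for real functions applies to its composition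
    with f. *)
Lemma IVT_ereal_decr (R : realType) (f : R -> \bar R) (a b : R) (y : \bar R) :
  a <= b -> {within `[a, b], continuous f} -> (f b <= y <= f a)%E ->
  exists2 c, c \in `[a, b] & f c = y.
Proof.
move=> ab fC yab.
have cC : {within `[a, b], continuous (fun x => contract (f x))}.
  by move=> x; apply: continuous_comp; [exact: fC|exact: continuous_contract].
have /andP[fby yfa] := yab.
have [|c cab /contract_inj fc] := @IVT R _ a b (contract y) ab cC; last by exists c.
by rewrite ge_min le_max !le_contract fby yfa orbT.
Qed.

(** * The decreasing transform of a uniform variable *)

Section decreasing.
Variables (R : realType) (phi : R -> \bar R) (psi : \bar R -> R).
Hypotheses (phi_decr : {in `[0, 1] &, forall x y, x < y -> (phi y < phi x)%E})
  (phi_cont : {within `[0, 1], continuous phi})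
  (phi0 : phi 0 = +oo%E)
  (psi_inv : {in `[0, 1], cancel phi psi}).

Lemma phi_leE : {in `[0, 1] &, forall x y, (phi x <= phi y)%E = (y <= x)}.
Proof.
move=> x y x01 y01; case: (ltgtP y x) => [yx|xy|->]; last by rewrite lexx.
  by rewrite ltW// phi_decr.
by apply/negbTE; rewrite -ltNge phi_decr.
Qed.

Lemma phi1_le x : x \in `[0, 1] -> (phi 1 <= phi x)%E.
Proof.
by move=> x01; rewrite phi_leE ?in_itv/= ?ler01 ?lexx//; move: x01; rewrite in_itv => /andP[].
Qed.

Lemma phi_onto y : (phi 1 <= y)%E -> exists2 q, q \in `[0, 1] & phi q = y.
Proof. by move=> y1; apply: IVT_ereal_decr => //; rewrite y1 phi0 leey. Qed.

Lemma psi_leE y q : (phi 1 <= y)%E -> q \in `[0, 1] ->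
  (psi y <= q) = (phi q <= y)%E.
Proof. by move=> /phi_onto[x x01 <-] q01; rewrite psi_inv// phi_leE. Qed.

(** A uniform variable can leave [0, 1] on a null set. With the value -oo there,
    a sum of such terms is -oo as soon as one variable leaves [0, 1], and every
    superlevel set is contained in [0, 1]. *)
Definition phi_out (x : R) : \bar R := if x \in `[0, 1] then phi x else -oo%E.

Lemma superlevel_phi_out (u : R) : [set x | (u%:E < phi_out x)%E] =
  if (u%:E < phi 1)%E then `[0, 1]%classic else `[0, psi u%:E[%classic.
Proof.
apply/seteqP; split => x /=; rewrite /phi_out.
  case: ifPn => [x01 ux|]; last by rewrite ltNge leNye.
  case: ifPn => //; rewrite -leNgt => u1 /=.
  have /andP[x0 x1] : 0 <= x <= 1 by move: x01; rewrite in_itv.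
  by rewrite in_itv/= x0 ltNge psi_leE// -ltNge.
case: ifPn => [u1 /= x01|]; first by rewrite x01 (lt_le_trans u1)// phi1_le.
rewrite -leNgt => u1 /=; rewrite in_itv/= => /andP[x0 xu].
have [q q01 qu] := phi_onto u1; move: xu; rewrite -qu psi_inv// => xq.
have x01 : x \in `[0, 1].
  by move: q01; rewrite !in_itv/= x0 => /andP[_ q1]; rewrite (le_trans (ltW xq)).
by rewrite x01 phi_decr.
Qed.

(** Its superlevel sets at real heights are intervals, and the rays ]u, +oo]
    with u real generate the sigma-algebra of the extended reals. *)
Lemma measurable_phi_out : measurable_fun setT phi_out.
Proof.
apply: (measurability _ (ErealGenOInfty.measurableE R)) => // _ [_ [u ->] <-].
rewrite setTI.
have -> : phi_out @^-1` `]u%:E, +oo[ = [set x | (u%:E < phi_out x)%E].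
  by apply/seteqP; split => x /=; rewrite in_itv/= andbT.
by rewrite superlevel_phi_out; case: ifP => _; exact: measurable_itv.
Qed.

Lemma uniform_prob_itv (b : bool) (q : R) : 0 <= q <= 1 ->
  uniform_prob (@ltr01 R) [set` Interval (BLeft 0) (BSide b q)] = q%:E.
Proof.
move=> /andP[q0 q1]; rewrite /uniform_prob.
rewrite (eq_integral (cst 1%:E)) => [|x]; last first.
  rewrite inE/= in_itv/= => /andP[x0 xq]; rewrite /uniform_pdf x0 subr0 invr1.
  by rewrite ifT//= (le_trans _ q1)//; move: xq; case: (b) => //= /ltW.
rewrite integral_cst//= mul1e lebesgue_measure_itv/= lte_fin oppr0 adde0.
by case: ltP => // q0'; congr EFin; apply/le_anti; rewrite q0.
Qed.

Lemma uniform_phi_out (u : R) :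
  uniform_prob (@ltr01 R) [set x | (u%:E < phi_out x)%E] = (psi_ext phi psi u)%:E.
Proof.
rewrite superlevel_phi_out /psi_ext; case: ifPn => [_|].
  by rewrite uniform_prob_itv// ler01 lexx.
by rewrite -leNgt => /phi_onto[q q01 <-]; rewrite psi_inv// uniform_prob_itv.
Qed.

(** The mean of the values of phi is at least phi 1, hence in the range of phi,
    where psi is the order-reversing inverse. This includes the case of a sum
    mixing +oo and -oo: then phi 1 = -oo and the mean is phi 1. On the right
    the condition that every variable lies in [0, 1] is implicit, which makes
    the event visibly measurable. *)
Lemma Mphi_le_iff (K : nat) (x : 'I_K -> R) (eps : R) : (0 < K)%N -> eps \in `[0, 1] ->
  phi eps \is a fin_num ->
  ((forall k, x k \in `[0, 1]) /\ Mphi phi psi x <= eps) <->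
  ((K%:R * fine (phi eps))%:E <= \sum_(k < K) phi_out (x k))%E.
Proof.
move=> K0 e01 pe.
have K0R : 0 < K%:R :> R by rewrite ltr0n.
have key : (forall k, x k \in `[0, 1]) ->
    (Mphi phi psi x <= eps) = ((K%:R * fine (phi eps))%:E <= \sum_(k < K) phi_out (x k))%E.
  move=> x01.
  have -> : (\sum_(k < K) phi_out (x k) = \sum_(k < K) phi (x k))%E.
    by apply: eq_bigr => k _; rewrite /phi_out x01.
  have sE : ((\sum_(k < K) phi (x k)) / K%:R%:E = (\sum_(k < K) phi (x k)) * K%:R^-1%:E)%E.
    by rewrite inver gt_eqF.
  rewrite /Mphi sE psi_leE//; first by rewrite lee_pdivlMr// muleC EFinM fineK.
  rewrite lee_pdivlMr//.
  have : (\sum_(k < K) phi 1 <= \sum_(k < K) phi (x k))%E.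
    by apply: lee_sum => k _; exact: phi1_le.
  by apply: le_trans; rewrite muleC mule_natl big_const card_ord iter_addr_0.
split=> [[x01]|h]; first by rewrite key.
suff x01 : forall k, x k \in `[0, 1] by rewrite key.
move=> k; apply: contraT => xk; move: h.
suff -> : (\sum_(k < K) phi_out (x k) = -oo)%E by [].
by apply/esum_eqNyP; exists k; rewrite mem_index_enum /phi_out (negbTE xk).
Qed.
End decreasing.

Theorem theorem7 (R : realType) (K : nat) (hK : (2 <= K)%N)
  (phi : R -> \bar R) (psi : \bar R -> R)
  (phi_decr : {in `[0, 1] &, forall x y, x < y -> (phi y < phi x)%E})
  (phi_cont : {within `[0, 1], continuous phi})
  (phi0 : phi 0 = +oo%E)
  (psi_inv : {in `[0, 1], cancel phi psi})
  (eps : R) (heps : 0 < eps < 1) (phi_eps : (0 <= phi eps)%E)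
  (d : measure_display) (T : measurableType d) (P : probability T R)
  (p : 'I_K -> {RV P >-> R}) (p_unif : forall k, uniform01 (p k)) :
  (P [set w | (forall k, p k w \in `[0%R, 1%R]) /\
              (Mphi phi psi (fun k => p k w) <= eps)%R]
   <= ereal_inf
        [set (\int[lebesgue_measure]_(u in
                `[(fine (phi eps) - t)%R, (fine (phi eps) + (K%:R - 1) * t)%R])
                (psi_ext phi psi u)%:E) / t%:E
         | t in [set t : R | (0 < t)%R /\ t%:E <= phi eps]])%E.
Proof.
have eps01 : eps \in `[0, 1] by case/andP: heps => e0 e1; rewrite in_itv/= !ltW.
have pe : phi eps \is a fin_num.
  have pey : (phi eps < +oo)%E.
    by rewrite -phi0 phi_decr ?in_itv/= ?lexx ?ler01//; case/andP: heps.
  by rewrite fin_numElt pey andbT (lt_le_trans _ phi_eps)// ltNy0.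
set s := fine (phi eps); set E := [set w | _].
pose X k := phi_out phi \o p k.
have mX k : measurable_fun setT (X k).
  by apply: (@measurableT_comp _ _ _ _ _ _ (phi_out phi) _ (p k)) => //;
     exact: measurable_phi_out phi_decr phi_cont phi0 psi_inv.
have -> : E = [set w | ((K%:R * s)%:E <= \sum_(k < K) X k w)%E].
  apply/seteqP; split => w; rewrite /E /=;
    by apply Mphi_le_iff => //; exact: leq_trans hK.
have survival k u : P [set w | (u%:E < X k w)%E] = (psi_ext phi psi u)%:E.
  rewrite -(uniform_phi_out phi_decr phi_cont phi0 psi_inv) -(p_unif k)//.
  rewrite -[X in measurable X]setTI; apply: measurable_lte => //.
  exact: measurable_phi_out phi_decr phi_cont phi0 psi_inv.
apply: le_ereal_inf_tmp => _ [t [t0 _] <-].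
rewrite inver gt_eqF// lee_pdivlMr// muleC.
have := sum_survival_ge P s mX t0.
under eq_bigr do under eq_integral do rewrite survival.
have sum_cst (y : \bar R) : (\sum_(k < K) y <= K%:R%:E * y)%E.
  by rewrite mule_natl big_const card_ord iter_addr_0.
move=> /le_trans/(_ (sum_cst _)); rewrite EFinM -muleA.
by rewrite lee_pmul2l// lte_fin ltr0n (leq_trans _ hK).
Qed.
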